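(* Let $\ell\ge3$, let $\mathcal{A}$ be an arrangement in $V=\mathbb{K}^\ell$, $H\in\mathcal{A}$ and $\mathcal{A}':=\mathcal{A}\setminus\{H\}$. Assume that $\mathcal{A}'$ is free with $\exp(\mathcal{A}')=(d_1,\ldots,d_\ell)$, $d_1\le\cdots\le d_\ell$. If $d:=|\mathcal{A}'|-|\mathcal{A}^H|\ge d_{\ell-2}$, then $\mathcal{A}$ is free, or strictly plus-one generated with $\mathrm{POexp}(\mathcal{A})=(d_1,\ldots,d_{\ell-2},d_{\ell-1}+1,d_\ell+1)$ and level $d_{\ell-1}+d_\ell-|\mathcal{A}|+|\mathcal{A}^H|+1$.
   Context: Let $\mathbb{K}$ be a field, $V=\mathbb{K}^\ell$, $S=\mathrm{Sym}^*(V^* )=\mathbb{K}[x_1,\ldots,x_\ell]$ and $\mathrm{Der}\,S=\bigoplus_{i=1}^\ell S\partial_{x_i}$. An arrangement $\mathcal{A}$ in $V$ is a finite set of linear hyperplanes in $V$; arrangements are assumed essential ($\bigcap_{H\in\mathcal{A}}H=\{0\}$) unless otherwise specified. For $H\in\mathcal{A}$ fix $\alpha_H\in V^*$ with $\ker\alpha_H=H$, and let $\mathcal{A}^H:=\{L\cap H\mid L\in\mathcal{A}\setminus\{H\}\}$ be the restriction, an arrangement in $H$. $D(\mathcal{A}):=\{\theta\in\mathrm{Der}\,S\mid\theta(\alpha_H)\in S\alpha_H\ (\forall H\in\mathcal{A})\}$, graded by polynomial degree: $\sum f_i\partial_{x_i}$ is homogeneous of degree $d$ if all $f_i\in S_d$.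 $\mathcal{A}$ is free with exponents $\exp(\mathcal{A})=(d_1,\ldots,d_\ell)$ if $D(\mathcal{A})=\bigoplus_{i=1}^\ell S\theta_i$ with $\theta_i$ homogeneous of degree $d_i$. $\theta_E=\sum_i x_i\partial_{x_i}$ is the Euler derivation. $\mathcal{A}$ is plus-one generated with exponents $\mathrm{POexp}(\mathcal{A})=(d_1,\ldots,d_\ell)$ and level $d$ if $D(\mathcal{A})$ has a minimal (graded) free resolution $$0\to S[-d-1]\xrightarrow{(\alpha,f_1,\ldots,f_\ell)}S[-d]\oplus\Big(\bigoplus_{i=1}^\ell S[-d_i]\Big)\to D(\mathcal{A})\to0,$$ i.e. there is a minimal set of homogeneous generators $\theta_1=\theta_E,\theta_2,\ldots,\theta_\ell,\varphi$ with $\deg\theta_i=d_i$ (so $d_1=1$), $\deg\varphi=d$, and a single relation (up to multiples) $\sum f_i\theta_i+\alpha\varphi=0$, $f_i\in S$, $\alpha\in V^*$. It is strictly plus-one generated if such a resolution can be chosen with $\alpha\ne0$. *)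

(* Defs.v *)
From mathcomp Require Import all_boot all_order all_algebra.
From mathcomp Require Import finmap mpoly.

Set Implicit Arguments.
Unset Strict Implicit.
Unset Printing Implicit Defensive.

Local Open Scope fset_scope.
Local Open Scope ring_scope.

(* V = K^l is the space of row vectors, and S = K[x_1, ..., x_l] is
   {mpoly K[l]}, whose component of degree 1 is V^*. *)
Section Arrangements.
Variables (K : fieldType) (l : nat).
Implicit Types (A : {fset {vspace 'rV[K]_l}}) (H : {vspace 'rV[K]_l}).

Definition arrangement A : Prop := forall H, H \in A -> \dim H = l.-1.

Definition essential A : Prop := (\bigcap_(H <- A) H)%VS = 0%VS.

Definition deletion A H : {fset {vspace 'rV[K]_l}} := A `\ H.

(* The hyperplanes L :&: H of H are kept as subspaces of V. *)
Definition restriction A H : {fset {vspace 'rV[K]_l}} :=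
  [fset (L :&: H)%VS | L in A `\ H].

Definition defining_form H (alpha : {mpoly K[l]}) : Prop :=
  alpha \is 1.-homog /\
  forall v : 'rV[K]_l, (v \in H) = (alpha.@[fun i => v 0 i] == 0).

(* The row vector (f_1, ..., f_l) stands for the sum of the f_i d/dx_i. *)
Local Notation Der := 'rV[{mpoly K[l]}]_l.

Definition der_app (theta : Der) (p : {mpoly K[l]}) : {mpoly K[l]} :=
  \sum_(i < l) theta 0 i * p^`M(i).

Definition der_homog (d : nat) (theta : Der) : Prop :=
  forall i : 'I_l, theta 0 i \is d.-homog.

Definition euler : Der := \row_(i < l) 'X_i.

(* A form alpha_H with kernel H is unique up to a nonzero scalar, so
   quantifying over all of them amounts to fixing one. *)
Definition logder A (theta : Der) : Prop :=
  forall H, H \in A -> forall alpha, defining_form H alpha ->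
  exists g : {mpoly K[l]}, der_app theta alpha = g * alpha.

Definition generates (I : finType) (g : I -> Der) (M : Der -> Prop) : Prop :=
  forall delta : Der,
    M delta <-> exists c : I -> {mpoly K[l]}, delta = \sum_i c i *: g i.

Definition irredundant (I : finType) (g : I -> Der) : Prop :=
  forall (i : I) (c : I -> {mpoly K[l]}), g i <> \sum_(j | j != i) c j *: g j.

Definition independent (I : finType) (g : I -> Der) : Prop :=
  forall c : I -> {mpoly K[l]},
    \sum_i c i *: g i = 0 -> forall i, c i = 0.

Definition free_with_exp A (d : l.-tuple nat) : Prop :=
  exists theta : 'I_l -> Der,
    [/\ forall i, der_homog (tnth d i) (theta i),
        generates theta (logder A)
      & independent theta].

Definition free_arrangement A : Prop :=
  exists d : l.-tuple nat, free_with_exp A d.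

(* theta_1, ..., theta_l followed by phi, the latter at index None. *)
Definition po_gens (theta : 'I_l -> Der) (phi : Der) (o : option 'I_l) : Der :=
  if o is Some i then theta i else phi.

(* The resolution
     0 -> S[-d-1] --(alpha, f)--> S[-d] (+) (+)_i S[-e_i] --> D(A) -> 0.
   In por_f_homog, f_i is homogeneous of degree d + 1 - e_i, hence zero when
   this is negative. *)
Record po_resolution A (e : l.-tuple nat) (d : nat)
    (theta : 'I_l -> Der) (phi : Der)
    (alpha : {mpoly K[l]}) (f : 'I_l -> {mpoly K[l]}) : Prop := {
  por_euler : forall i : 'I_l, i = 0%N :> nat -> theta i = euler;
  por_theta_homog : forall i, der_homog (tnth e i) (theta i);
  por_phi_homog : der_homog d phi;
  por_generates : generates (po_gens theta phi) (logder A);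
  por_minimal : irredundant (po_gens theta phi);
  por_alpha_homog : alpha \is 1.-homog;
  por_f_homog : forall i m, m \in msupp (f i) -> (mdeg m + tnth e i = d.+1)%N;
  por_exact : forall (g : 'I_l -> {mpoly K[l]}) (c : {mpoly K[l]}),
    \sum_i g i *: theta i + c *: phi = 0 <->
    exists h : {mpoly K[l]}, (forall i, g i = h * f i) /\ c = h * alpha;
  por_injective : forall h : {mpoly K[l]},
    (forall i, h * f i = 0) -> h * alpha = 0 -> h = 0
}.

Definition plus_one_generated A (e : l.-tuple nat) (d : nat) : Prop :=
  exists theta phi alpha f, po_resolution A e d theta phi alpha f.

Definition strictly_plus_one_generated A (e : l.-tuple nat) (d : nat) : Prop :=
  exists theta phi alpha f,
    po_resolution A e d theta phi alpha f /\ alpha != 0.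

End Arrangements.

(* Main.v *)
(* Choose w with alpha_H(w) = 1. The ring endomorphism rho : S -> S, x_i |->
   x_i - w_i alpha_H, has kernel (alpha_H), so it realizes S / alpha_H as a
   subring of S and shows that linear forms are prime. If b is the product of
   the alpha_L over all L in A' but one for each X in A^H, then rho(b), of
   degree d = |A'| - |A^H|, divides rho(theta(alpha_H)) for theta in D(A').
   Writing rho(theta_i(alpha_H)) = f_i rho(b) for a basis (theta_i) of D(A'), the
   derivation sum c_i theta_i is in D(A) iff sum rho(c_i) f_i = 0, where f_i is
   homogeneous of degree d_i - d.

   If some f_i is a nonzero constant, or only one f_i is nonzero, then A is free.
   Otherwise d >= d_{l-2} forces f_i = 0 for i <= l-2. The derivations
   (prod_{L' <> L} alpha_L') w_L, with w_L in L and not in H, show that the ideal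
   (f_{l-1}, f_l) contains the cofactors prod_{Y <> X} beta_Y of the forms
   defining A^H, whose gcd is 1; hence f_{l-1} and f_l are coprime, and D(A) is
   generated by theta_1, ..., theta_{l-2}, alpha_H theta_{l-1}, alpha_H theta_l
   and phi = f_l theta_{l-1} - f_{l-1} theta_l. All coefficients of the only
   relation between these vanish at 0, so that the generators are minimal. *)
From HB Require Import structures.
Require Import Defs.
From mathcomp Require Import all_boot all_order all_algebra.
From mathcomp Require Import fingroup perm ring zify.
From mathcomp Require Import finmap mpoly.

Set Implicit Arguments.
Unset Strict Implicit.
Unset Printing Implicit Defensive.

Import Order.TTheory GRing.Theory Num.Theory.
Local Open Scope fset_scope.
Local Open Scope ring_scope.

(** * Divisibility in integral domains *)

Section Divisibility.
Variable R : idomainType.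
Implicit Types a b c g p z : R.

Definition rdvd a b := exists c, b = c * a.

Definition prime_elt p :=
  [/\ p != 0, ~ rdvd p 1 & forall a b, rdvd p (a * b) -> rdvd p a \/ rdvd p b].

Lemma rdvd_mull a b c : rdvd a b -> rdvd a (c * b).
Proof. by case=> x ->; exists (c * x); rewrite mulrA. Qed.

Lemma rdvd_mulr a b c : rdvd a b -> rdvd a (b * c).
Proof. by rewrite mulrC; exact: rdvd_mull. Qed.

Lemma rdvdD a b c : rdvd a b -> rdvd a c -> rdvd a (b + c).
Proof. by case=> x -> [y ->]; exists (x + y); rewrite mulrDl. Qed.

Lemma rdvd_prodP (I : eqType) (r : seq I) (F : I -> R) p :
  prime_elt p -> rdvd p (\prod_(i <- r) F i) ->
  exists2 i, i \in r & rdvd p (F i).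
Proof.
move=> [_ p1 pP]; elim: r => [|i r IHr]; first by rewrite big_nil.
rewrite big_cons => /pP[pi|/IHr[j jr pj]].
- by exists i; rewrite ?mem_head.
- by exists j; rewrite // inE jr orbT.
Qed.

(** The primes are stripped off one at a time: each divides [a * z] but not [a], so it divides [z],
    and cancelling it leaves the same claim for the remaining product. *)
Lemma prod_rdvd_cancel (I : eqType) (r : seq I) (F : I -> R) a z :
  (forall i, i \in r -> prime_elt (F i)) ->
  (forall i, i \in r -> ~ rdvd (F i) a) ->
  rdvd (\prod_(i <- r) F i) (a * z) -> rdvd (\prod_(i <- r) F i) z.
Proof.
elim: r z => [|i r IHr] z Fpr Fa; first by exists z; rewrite big_nil mulr1.
have [Fi0 _ FiP] := Fpr i (mem_head _ _).
rewrite !big_cons => -[c Ec].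
have /FiP[/(Fa _ (mem_head _ _)) // | [y Ey]] : rdvd (F i) (a * z).
  by rewrite Ec; exists (c * \prod_(j <- r) F j); ring.
case: (IHr y).
- by move=> j jr; apply: Fpr; rewrite inE jr orbT.
- by move=> j jr; apply: Fa; rewrite inE jr orbT.
- exists c; apply: (mulIf Fi0); transitivity (a * z); first by rewrite Ey; ring.
  by rewrite Ec; ring.
- by move=> t Et; exists t; rewrite Ey Et; ring.
Qed.

Lemma prod_rdvd_mul (I : eqType) (r : seq I) (F : I -> R) b z :
  (forall i, i \in r -> prime_elt (F i)) ->
  (forall i, i \in r -> ~ rdvd (F i) b) ->
  rdvd (\prod_(i <- r) F i) z -> rdvd b z -> rdvd (\prod_(i <- r) F i * b) z.
Proof.
move=> Fpr Fb Pz [c Ec]; move: Pz; rewrite Ec mulrC.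
move=> /(prod_rdvd_cancel Fpr Fb)[t ->]; exists t; ring.
Qed.

Lemma prod_rdvd_coprime (I : eqType) (r : seq I) (F : I -> R) z :
  uniq r -> (forall i, i \in r -> prime_elt (F i)) ->
  {in r &, forall i j, i != j -> ~ rdvd (F i) (F j)} ->
  (forall i, i \in r -> rdvd (F i) z) -> rdvd (\prod_(i <- r) F i) z.
Proof.
elim: r => [|i r IHr] /=; first by exists z; rewrite big_nil mulr1.
move=> /andP[ir ur] Fpr Fco Fz; rewrite big_cons mulrC; apply: prod_rdvd_mul.
- by move=> j jr; apply: Fpr; rewrite inE jr orbT.
- move=> j jr; apply: Fco; rewrite ?mem_head ?inE ?jr ?orbT //.
  by apply: contraNneq ir => <-.
- apply: IHr => // [j jr|j k jr kr|j jr].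
  + by apply: Fpr; rewrite inE jr orbT.
  + by apply: Fco; rewrite inE ?jr ?kr orbT.
  + by apply: Fz; rewrite inE jr orbT.
- exact/Fz/mem_head.
Qed.

(* Says that the cofactors of pairwise coprime primes have gcd 1. *)
Lemma rdvd_cofactors (I : eqType) (r : seq I) (F : I -> R) g c :
  uniq r -> r != [::] -> g != 0 ->
  (forall i, i \in r -> prime_elt (F i)) ->
  {in r &, forall i j, i != j -> ~ rdvd (F i) (F j)} ->
  (forall i, i \in r -> rdvd g (c * \prod_(j <- r | j != i) F j)) ->
  rdvd g c.
Proof.
move=> + + g0; elim: r c => // i r IHr c /= /andP[ir ur] _ Fpr Fco gP.
have gi : rdvd g (c * \prod_(j <- r) F j).
  have := gP i (mem_head _ _); rewrite big_cons eqxx /=.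
  rewrite big_seq_cond (eq_bigl (fun j => j \in r)) -?big_seq // => j.
  by case: (boolP (j \in r)) => //= jr; apply: contraNneq ir => <-.
have [r0|r0] := eqVneq r [::].
  by move: gi; rewrite r0 big_nil mulr1.
have [s Es] : rdvd g (c * F i).
  apply: IHr => // [j jr|j k jr kr|j jr].
  - by apply: Fpr; rewrite inE jr orbT.
  - by apply: Fco; rewrite inE ?jr ?kr orbT.
  - have := gP j; rewrite inE jr orbT big_cons => /(_ isT).
    suff -> : i != j by rewrite mulrA.
    by apply: contraNneq ir => ->.
have [Fi0 _ FiP] := Fpr i (mem_head _ _).
case: gi => s' Es'.
(* Comparing [Es] with [Es'] gives [P * s = s' * F i], where [P] is the product over [r]. The prime
   [F i] cannot divide [P], so it divides [s] and cancels from [Es]. *)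
have /FiP[|[t Et]] : rdvd (F i) ((\prod_(j <- r) F j) * s).
- exists s'; apply: (mulIf g0).
  transitivity (c * (\prod_(j <- r) F j) * F i); last by rewrite Es'; ring.
  by rewrite -mulrA -Es; ring.
- move=> /(rdvd_prodP (Fpr i (mem_head _ _)))[j jr /Fco[]].
  + exact: mem_head.
  + by rewrite inE jr orbT.
  + by apply: contraNneq ir => ->.
- by exists t; apply: (mulIf Fi0); rewrite Es Et; ring.
Qed.

End Divisibility.

(** * Linear forms *)

Section LinearForms.
Variables (K : fieldType) (l : nat).
Local Notation S := {mpoly K[l]}.
Implicit Types (a b v w : 'rV[K]_l) (p q : S).

Definition dot a v : K := \sum_i a 0 i * v 0 i.
Definition lin a : S := \sum_i a 0 i *: 'X_i.

Lemma dotDl a b v : dot (a + b) v = dot a v + dot b v.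
Proof.
by rewrite /dot -big_split; apply: eq_bigr => i _; rewrite /= mxE mulrDl.
Qed.

Lemma dotZl c a v : dot (c *: a) v = c * dot a v.
Proof. by rewrite /dot mulr_sumr; apply: eq_bigr => i _; rewrite mxE mulrA. Qed.

Lemma dotC a v : dot a v = dot v a.
Proof. by apply: eq_bigr => i _; rewrite mulrC. Qed.

Lemma dotZr c a v : dot a (c *: v) = c * dot a v.
Proof. by rewrite dotC dotZl dotC. Qed.

Lemma dotBl a b v : dot (a - b) v = dot a v - dot b v.
Proof. by rewrite -scaleN1r dotDl dotZl mulN1r. Qed.

Lemma dotBr a v w : dot a (v - w) = dot a v - dot a w.
Proof. by rewrite dotC dotBl !(dotC a). Qed.

Lemma dot0 v : dot 0 v = 0.
Proof. by rewrite -(scale0r 0) dotZl mul0r. Qed.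

Lemma dot_delta a i : dot a (delta_mx 0 i) = a 0 i.
Proof.
rewrite /dot (bigD1 i) //= mxE !eqxx mulr1 big1 ?addr0 // => j ji.
by rewrite mxE (negPf ji) andbF mulr0.
Qed.

Lemma dot_inj a b : (forall v, dot a v = dot b v) -> a = b.
Proof. by move=> ab; apply/rowP => i; rewrite -!dot_delta. Qed.

Lemma linD a b : lin (a + b) = lin a + lin b.
Proof. by rewrite /lin -big_split; apply: eq_bigr => i _; rewrite /= mxE scalerDl. Qed.

Lemma linZ c a : lin (c *: a) = c *: lin a.
Proof. by rewrite /lin scaler_sumr; apply: eq_bigr => i _; rewrite mxE scalerA. Qed.

Lemma linB a b : lin (a - b) = lin a - lin b.
Proof. by rewrite -scaleN1r linD linZ scaleN1r. Qed.

Lemma mcoeff_lin a i : (lin a)@_U_(i) = a 0 i.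
Proof.
rewrite /lin raddf_sum (bigD1 i) //= linearZ /= mcoeffX eqxx mulr1.
rewrite big1 ?addr0 // => j ji; rewrite linearZ /= mcoeffX.
by rewrite eq_mnm1 (negPf ji) mulr0.
Qed.

Lemma lin_eq0 a : (lin a == 0) = (a == 0).
Proof.
apply/eqP/eqP => [a0|->]; last by rewrite -(scale0r 0) linZ scale0r.
by apply/rowP => i; rewrite -mcoeff_lin a0 mcoeff0 mxE.
Qed.

Lemma lin_homog a : lin a \is 1.-homog.
Proof. by apply: rpred_sum => i _; apply: rpredZ; rewrite dhomogX /= mdeg1. Qed.

Lemma homog1_lin p : p \is 1.-homog -> exists a, p = lin a.
Proof.
move=> hp; exists (\row_i p@_U_(i)); apply/mpolyP => m.
have [/mdeg1P[i /eqP ->]|m1] := boolP (mdeg m == 1%N).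
  by rewrite mcoeff_lin mxE.
by rewrite !(dhomog_nemf_coeff _ m1) // lin_homog.
Qed.

Lemma meval_lin a v : (lin a).@[fun i => v 0 i] = dot a v.
Proof.
rewrite /lin raddf_sum; apply: eq_bigr => i _.
by rewrite /= mevalZ mevalXU.
Qed.

Lemma der_app_lin (theta : 'rV[S]_l) a :
  der_app theta (lin a) = \sum_i a 0 i *: theta 0 i.
Proof.
apply: eq_bigr => i _; rewrite /lin raddf_sum (bigD1 i) //=.
rewrite big1 ?addr0 => [|j ji]; rewrite mderivZ mderivX mnm1E.
  rewrite eqxx -scalerAr /= -/(1%:R) scale1r (_ : (U_(i) - U_(i))%MM = 0%MM) ?mpolyX0 ?mulr1 //.
  by apply/mnmP => j; rewrite mnmBE subnn mnm0E.
by rewrite (negPf ji) scale0r scaler0.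
Qed.

End LinearForms.

(** * Homogeneous polynomials *)

Section Homogeneous.
Variables (K : fieldType) (l : nat).
Local Notation S := {mpoly K[l]}.
Implicit Types (p q c : S).

Lemma pihomogM d e c q : q \is d.-homog ->
  pihomog mdeg e (c * q) = if (d <= e)%N then pihomog mdeg (e - d) c * q else 0.
Proof.
move=> hq; elim/mpolyind: c => [|x m c _ _ IHc].
  by rewrite mul0r !raddf0 mul0r if_same.
rewrite mulrDl pihomogD IHc -scalerAl linearZ /= pihomogD linearZ /= pihomogX.
have hmq : 'X_[m] * q \is (mdeg m + d).-homog by rewrite dhomogM ?dhomogX /=.
have [de|ed] := leqP d e.
  have [me|me] := eqVneq (mdeg m) (e - d)%N.
    by rewrite mulrDl -scalerAl (pihomog_dE (d := e)) // -(subnK de) -me.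
  rewrite (pihomog_ne0 _ hmq) ?scaler0 ?add0r //.
  by apply: contraNneq me => <-; rewrite addnK.
rewrite (pihomog_ne0 _ hmq) ?scaler0 ?addr0 //.
by apply: contraTneq ed => <-; rewrite -leqNgt leq_addl.
Qed.

(** Taking components of degree [e] in [p = c * q] and cancelling [q] identifies [c] with its own
    component of degree [e - d], or with 0 if [e < d]. *)
Lemma homog_quotient d e p q c : q != 0 -> q \is d.-homog -> p \is e.-homog ->
  p = c * q -> c = 0 \/ (d <= e)%N /\ c \is (e - d).-homog.
Proof.
move=> q0 hq hp Ep; have := pihomogM e c hq; rewrite -Ep (pihomog_dE hp) Ep.
case: leqP => [de /(mulIf q0) ->|_ /eqP].
  by right; split=> //; apply: pihomogP.
by rewrite mulf_eq0 (negPf q0) orbF => /eqP; left.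
Qed.

Lemma homog0C p : p \is 0.-homog -> p = (p@_0%MM)%:MP.
Proof.
move=> hp; apply/mpolyP => m; rewrite mcoeffC.
have [->|m0] := eqVneq m 0%MM; first by rewrite mulr1.
by rewrite mulr0 (dhomog_nemf_coeff hp) // mdeg_eq0.
Qed.

Lemma homog_meval0 d p : (0 < d)%N -> p \is d.-homog -> p.@[fun=> 0] = 0.
Proof.
move=> d0 hp; rewrite mevalE big_seq big1 // => m mp.
have md : mdeg m = d := dhomog_mf hp mp.
case: (pickP (fun i => m i != 0%N)) => [i mi|m0].
  by rewrite (bigD1 i) //= expr0n (negPf mi) mul0r mulr0.
move: d0; rewrite -md mdegE big1 // => i _; apply/eqP.
by have := m0 i; case: eqP.
Qed.

Lemma homog_prod_seq (I : eqType) (r : seq I) (F : I -> S) :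
  {in r, forall i, F i \is 1.-homog} -> \prod_(i <- r) F i \is (size r).-homog.
Proof.
elim: r => [|i r IHr] Fh; first by rewrite big_nil dhomog1.
rewrite big_cons; change (size (i :: r)) with (1 + size r)%N.
rewrite dhomogM ?Fh ?mem_head ?IHr // => j jr.
by apply: Fh; rewrite inE jr orbT.
Qed.

End Homogeneous.

(** * Reduction modulo a linear form *)

Section Retraction.
Variables (K : fieldType) (l : nat).
Local Notation S := {mpoly K[l]}.
Implicit Types (a b v w : 'rV[K]_l) (p q : S).

(* For [dot a w = 1], the endomorphism of S dual to the projection along w
   onto the kernel of a. It identifies S / (lin a) with a subring of S. *)
Definition retract a w p : S := p \mPo [tuple 'X_i - w 0 i *: lin a | i < l].

HB.instance Definition _ a w := GRing.RMorphism.copy (retract a w)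
  (comp_mpoly [tuple 'X_i - w 0 i *: lin a | i < l]).

Variables (a w : 'rV[K]_l).
Local Notation rho := (retract a w).

Lemma retractX i : rho 'X_i = 'X_i - w 0 i *: lin a.
Proof. by rewrite /retract comp_mpolyXU nth_mktuple. Qed.

Lemma retractC c : rho c%:MP = c%:MP.
Proof. exact: comp_mpolyC. Qed.

Lemma retractZ c p : rho (c *: p) = c *: rho p.
Proof. exact: comp_mpolyZ. Qed.

Lemma retract_lin b : rho (lin b) = lin (b - dot b w *: a).
Proof.
rewrite linB linZ /dot scaler_suml -sumrB raddf_sum.
by apply: eq_bigr => i _; rewrite /= retractZ retractX scalerBr scalerA.
Qed.

Lemma retract_homog d p : p \is d.-homog -> rho p \is d.-homog.
Proof.
move=> hp; rewrite /retract comp_mpolyEX big_seq rpred_sum // => m mp.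
have <- : mdeg m = d := dhomog_mf hp mp.
rewrite rpredZ // comp_mpolyX mdegE.
elim/big_rec2: _ => [|i n q _ hq]; first exact: dhomog1.
apply: dhomogM => //; rewrite tnth_mktuple.
have hX : 'X_i - w 0 i *: lin a \is 1.-homog.
  by rewrite rpredB ?rpredZ ?lin_homog // dhomogX /= mdeg1.
by have := dhomogMn (m i) hX; rewrite mul1n.
Qed.

(** The substitution changes each variable by a multiple of [lin a], and congruence modulo [lin a]
    respects sums and products. *)
Lemma retract_mod p : rdvd (lin a) (p - rho p).
Proof.
elim/mpolyind: p => [|c m p _ _ IHp]; first by exists 0; rewrite rmorph0 subrr mul0r.
rewrite rmorphD /= opprD addrACA; apply: rdvdD => //.
rewrite retractZ -scalerBr -mul_mpolyC; apply: rdvd_mull.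
rewrite /retract comp_mpolyX mpolyXE_id.
elim/big_ind2: _ => [|q1 p1 q2 p2 [c1 E1] [c2 E2]|i _].
- by exists 0; rewrite subrr mul0r.
- exists (c1 * p2 + q1 * c2).
  transitivity ((p1 - q1) * p2 + q1 * (p2 - q2)).
    by ring.
  by rewrite E1 E2; ring.
rewrite tnth_mktuple subrXX; apply: rdvd_mulr; exists (w 0 i)%:MP.
by rewrite opprB addrC subrK mul_mpolyC.
Qed.

Hypothesis aw : dot a w = 1.

Lemma retract_form : rho (lin a) = 0.
Proof. by rewrite retract_lin aw scale1r subrr; apply/eqP; rewrite lin_eq0. Qed.

Lemma retractK p : rho (rho p) = rho p.
Proof.
have [c Ec] := retract_mod p; apply/eqP; rewrite eq_sym -subr_eq0 -rmorphB Ec.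
by rewrite rmorphM /= retract_form mulr0.
Qed.

Lemma rdvd_linE p : rdvd (lin a) p <-> rho p = 0.
Proof.
split=> [[c ->]|p0]; first by rewrite rmorphM /= retract_form mulr0.
by have := retract_mod p; rewrite p0 subr0.
Qed.

End Retraction.

(** * Primality of linear forms *)

Section Primality.
Variables (K : fieldType) (l : nat).
Implicit Types (a b v w : 'rV[K]_l).

Lemma dot_neq0 a : a != 0 -> exists w, dot a w = 1.
Proof.
case: (pickP (fun i => a 0 i != 0)) => [i ai _|a0 /eqP[]].
  by exists ((a 0 i)^-1 *: delta_mx 0 i); rewrite dotZr dot_delta mulVf.
by apply/rowP => i; rewrite mxE; have := a0 i; case: eqP.
Qed.

Lemma prime_lin a : a != 0 -> prime_elt (lin a).
Proof.
move=> a0; have [w aw] := dot_neq0 a0; split=> [||p q].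
- by rewrite lin_eq0.
- by move=> /(rdvd_linE aw)/eqP; rewrite rmorph1 oner_eq0.
move=> /(rdvd_linE aw)/eqP; rewrite rmorphM /= mulf_eq0.
by case/orP => /eqP/(rdvd_linE aw); [left|right].
Qed.

Lemma rdvd_lin a b : a != 0 -> rdvd (lin a) (lin b) -> exists c, b = c *: a.
Proof.
move=> a0; have [w aw] := dot_neq0 a0 => /(rdvd_linE aw)/eqP.
by rewrite retract_lin lin_eq0 subr_eq0 => /eqP ->; exists (dot b w).
Qed.

Lemma rdvd_linC a c : a != 0 -> rdvd (lin a) c%:MP -> c = 0.
Proof.
move=> a0; have [w aw] := dot_neq0 a0 => /(rdvd_linE aw).
by rewrite retractC => /eqP; rewrite mpolyC_eq0 => /eqP.
Qed.

End Primality.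

(** * Hyperplanes and logarithmic derivations *)

Section Hyperplanes.
Variables (K : fieldType) (l : nat).
Local Notation S := {mpoly K[l]}.
Local Notation Der := 'rV[S]_l.
Implicit Types (a b v w : 'rV[K]_l) (L H : {vspace 'rV[K]_l}).
Implicit Types (A : {fset {vspace 'rV[K]_l}}) (theta : Der).

Definition normal H a := forall v, (v \in H) = (dot a v == 0).

(** For a hyperplane, [H^C] is a line. The form reads off, from the projection to this line along
    [H], a coordinate that is nonzero on its chosen generator; the value 0 occurs only when [H^C] is
    zero. *)
Definition hform H : 'rV[K]_l :=
  if [pick i | vpick (H^C)%VS 0 i != 0] is Some i
  then \row_j (daddv_pi (H^C)%VS H (delta_mx 0 j)) 0 i else 0.

Lemma dim_rV : dim 'rV[K]_l = l.
Proof. exact: mul1n. Qed.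

Lemma hformP H : (0 < l)%N -> \dim H = l.-1 -> normal H (hform H).
Proof.
move=> l0 dH v; set pi := daddv_pi (H^C)%VS H.
have dC : \dim (H^C)%VS = 1%N.
  by rewrite dimv_compl dimvf dim_rV dH; lia.
set w := vpick (H^C)%VS.
have w0 : w != 0 by rewrite vpick0 -dimv_eq0 dC.
have HC : (H^C)%VS = <[w]>%VS.
  apply/eqP; rewrite eq_sym eqEdim dC dim_vline w0 andbT.
  by apply/subvP => _ /vlineP[k ->]; rewrite memvZ ?memv_pick.
have [i wi] : exists i, w 0 i != 0.
  case: (pickP (fun i => w 0 i != 0)) => [i wi|w00]; first by exists i.
  by case/eqP: w0; apply/rowP => i; rewrite mxE; have := w00 i; case: eqP.
rewrite /hform -/w; case: pickP => [{wi}i wi|/(_ i)]; last by rewrite wi.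
have -> : dot (\row_j (pi (delta_mx 0 j)) 0 i) v = (pi v) 0 i.
  rewrite [in RHS](row_sum_delta v) linear_sum summxE.
  by apply: eq_bigr => j _; rewrite linearZ !mxE mulrC.
have [c Ec] : exists c, pi v = c *: w by apply/vlineP; rewrite -HC memv_pi.
have capC : (H^C :&: H = 0)%VS by rewrite capvC capv_compl.
have Ev := daddv_pi_add (w := v) capC.
rewrite addvC addv_complf memvf in Ev; have {}Ev := Ev isT.
have capC' : (H :&: H^C = 0)%VS by rewrite capv_compl.
rewrite Ec mxE mulf_eq0 (negPf wi) orbF.
apply/idP/eqP => [vH|c0]; last by rewrite -Ev -/pi Ec c0 scale0r add0r memv_pi.
have : pi v = 0.
  by apply: (addIr (daddv_pi H (H^C)%VS v)); rewrite Ev daddv_pi_id // add0r.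
by rewrite Ec => /eqP; rewrite scaler_eq0 (negPf w0) orbF => /eqP.
Qed.

Lemma normal_neq0 H a : (0 < l)%N -> \dim H = l.-1 -> normal H a -> a != 0.
Proof.
move=> l0 dH nH; apply/eqP => a0.
have HT : H = fullv by apply/vspaceP => v; rewrite nH a0 dot0 eqxx memvf.
by move: dH; rewrite HT dimvf dim_rV; lia.
Qed.

Lemma normal_inj H L a : normal H a -> normal L a -> H = L.
Proof. by move=> nH nL; apply/vspaceP => v; rewrite nH nL. Qed.

Lemma normalZ H a c : c != 0 -> normal H a -> normal H (c *: a).
Proof. by move=> c0 nH v; rewrite nH dotZl mulf_eq0 (negPf c0). Qed.

(** Every vector differs from a multiple of [w] by an element of [H], so a form vanishing on [H] is
    determined by its value at [w]. *)
Lemma vanish_normal H a b w : normal H a -> dot a w = 1 ->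
  (forall v, v \in H -> dot b v = 0) -> b = dot b w *: a.
Proof.
move=> nH aw bH; apply: dot_inj => v; rewrite dotZl.
have vH : v - dot a v *: w \in H by rewrite nH dotBr dotZr aw mulr1 subrr.
by have /eqP := bH _ vH; rewrite dotBr dotZr subr_eq0 mulrC => /eqP.
Qed.

Lemma defining_formP H alpha :
  defining_form H alpha <-> exists2 a, alpha = lin a & normal H a.
Proof.
split=> [[/homog1_lin[a ->] aP]|[a -> aP]].
  by exists a => // v; rewrite aP meval_lin.
by split=> [|v]; [exact: lin_homog | rewrite meval_lin aP].
Qed.

Lemma der_app_sum (I : finType) (c : I -> S) (theta : I -> Der) p :
  der_app (\sum_i c i *: theta i) p = \sum_i c i * der_app (theta i) p.
Proof.
rewrite /der_app; under eq_bigr do rewrite summxE mulr_suml.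
rewrite exchange_big; apply: eq_bigr => i _; rewrite mulr_sumr.
by apply: eq_bigr => j _; rewrite mxE mulrA.
Qed.

Lemma der_app_linZ theta c a :
  der_app theta (lin (c *: a)) = c *: der_app theta (lin a).
Proof.
by rewrite !der_app_lin scaler_sumr; apply: eq_bigr => i _; rewrite mxE scalerA.
Qed.

Lemma der_app_linD theta a b :
  der_app theta (lin (a + b)) = der_app theta (lin a) + der_app theta (lin b).
Proof.
by rewrite !der_app_lin -big_split; apply: eq_bigr => i _; rewrite mxE scalerDl.
Qed.

Lemma der_app_homog d theta a :
  der_homog d theta -> der_app theta (lin a) \is d.-homog.
Proof. by move=> th; rewrite der_app_lin rpred_sum // => i _; rewrite rpredZ ?th. Qed.

Lemma der_app_euler a : der_app (euler K l) (lin a) = lin a.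
Proof. by rewrite der_app_lin; apply: eq_bigr => i _; rewrite /euler mxE. Qed.

Definition const_der p w : Der := \row_i (w 0 i *: p).

Lemma der_app_const p w a : der_app (const_der p w) (lin a) = dot a w *: p.
Proof.
rewrite der_app_lin /dot scaler_suml.
by apply: eq_bigr => i _; rewrite mxE scalerA.
Qed.

Section Logarithmic.
Variable A : {fset {vspace 'rV[K]_l}}.
Hypotheses (l0 : (0 < l)%N) (hA : arrangement A).

Lemma hform_normal L : L \in A -> normal L (hform L).
Proof. by move=> LA; apply: hformP => //; apply: hA. Qed.

Lemma hform_neq0 L : L \in A -> hform L != 0.
Proof. by move=> LA; apply: (normal_neq0 l0 (hA LA)); apply: hform_normal. Qed.

Lemma hform_inj L L' c : L \in A -> L' \in A -> hform L' = c *: hform L -> L = L'.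
Proof.
move=> LA L'A E; have c0 : c != 0.
  by apply: contraTneq (hform_neq0 L'A) => c0; rewrite E c0 scale0r eqxx.
apply: (@normal_inj _ _ (hform L')); last exact: hform_normal.
by rewrite E; apply: normalZ => //; apply: hform_normal.
Qed.

(** All defining forms of a hyperplane are scalar multiples of [hform], so one test per hyperplane
    suffices. *)
Lemma logderP theta : logder A theta <->
  forall L, L \in A -> rdvd (lin (hform L)) (der_app theta (lin (hform L))).
Proof.
split=> [D L LA|D L LA alpha /defining_formP[a -> na]].
  have /(D L LA)// : defining_form L (lin (hform L)).
  by apply/defining_formP; exists (hform L); [|exact: hform_normal].
have [w aw] := dot_neq0 (hform_neq0 LA).
have -> : a = dot a w *: hform L.
  apply: vanish_normal aw _; first exact: hform_normal.
  by move=> v; rewrite na => /eqP.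
rewrite der_app_linZ linZ; have [g ->] := D L LA.
by exists g; rewrite scalerAr.
Qed.

(** Choose [u] in [H] but not in [L], and [c] such that [hform L' - c *: hform L] vanishes at [u].
    Since [u] and [L :&: H] span [H], this difference vanishes on [H] and is a multiple of
    [hform H]; the multiple is nonzero because [L] and [L'] differ. *)
Lemma hform_pencil H L L' : H \in A -> L \in A -> L' \in A ->
  L != H -> L != L' -> (L :&: H = L' :&: H)%VS ->
  exists c e, e != 0 /\ hform L' = c *: hform L + e *: hform H.
Proof.
move=> HA LA L'A LH LL' LHL'.
have nH := hform_normal HA; have nL := hform_normal LA; have nL' := hform_normal L'A.
have [u uH uL] : exists2 u, u \in H & u \notin L.
  apply/subvPn; apply: contraNN LH => HL.
  by rewrite eq_sym eqEdim HL (hA LA) (hA HA) leqnn.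
have Lu : dot (hform L) u != 0 by rewrite -nL.
have [w Hw] := dot_neq0 (hform_neq0 HA).
pose c := dot (hform L') u / dot (hform L) u.
pose b := hform L' - c *: hform L.
have Eb : b = dot b w *: hform H.
  apply: (vanish_normal nH Hw) => v vH.
  pose t := dot (hform L) v / dot (hform L) u.
  have vL : v - t *: u \in (L :&: H)%VS.
    rewrite memv_cap nL dotBr dotZr /t divfK // subrr eqxx /=.
    by rewrite memvB // memvZ.
  move: vL; rewrite LHL' memv_cap nL' dotBr dotZr subr_eq0 => /andP[/eqP L'v _].
  by rewrite /b dotBl dotZl L'v /t /c; field.
exists c, (dot b w); rewrite -Eb; split; last by rewrite /b addrC subrK.
apply: contraNneq LL' => b0; apply/eqP; apply: (@hform_inj _ _ c) => //.
by apply/eqP; rewrite -subr_eq0 -/b Eb b0 scale0r.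
Qed.

End Logarithmic.
End Hyperplanes.

(** * The values of D(A') on the deleted form *)

Section Deletion.
Variables (K : fieldType) (l : nat).
Variables (A : {fset {vspace 'rV[K]_l}}) (H : {vspace 'rV[K]_l}).
Hypotheses (l0 : (0 < l)%N) (hA : arrangement A) (HA : H \in A).
Variable w : 'rV[K]_l.
Hypothesis Hw : dot (hform H) w = 1.
Local Notation S := {mpoly K[l]}.
Local Notation A' := (deletion A H).
Local Notation AH := (restriction A H).
Local Notation rho := (retract (hform H) w).
Implicit Types (L X : {vspace 'rV[K]_l}) (theta : 'rV[S]_l).

(** For [L] in [A'], the linear form cutting out [L :&: H] in [H], pulled back to the whole space
    along [w]. *)
Definition beta L : S := rho (lin (hform L)).

(* A hyperplane of A' through the subspace X of H; junk unless X is in A^H. *)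
Definition rep X := nth H A' (find (fun L => (L :&: H)%VS == X) A').
Definition reps := [seq rep X | X <- AH].
Definition others := [seq L <- A' | L \notin reps].

(* Terao's polynomial B, as an element of the subring [rho S] of S. *)
Definition terao_poly : S := \prod_(L <- others) beta L.

Lemma deletionP L : L \in A' -> L \in A /\ L != H.
Proof. by rewrite in_fsetD1 => /andP[]. Qed.

Lemma restriction_in L : L \in A' -> (L :&: H)%VS \in AH.
Proof. by move=> LA; apply/imfsetP; exists L. Qed.

Lemma repP X : X \in AH -> rep X \in A' /\ (rep X :&: H)%VS = X.
Proof.
move=> /imfsetP[/= L LA EX].
have hX : has (fun L => (L :&: H)%VS == X) A'.
  by apply/hasP; exists L => //; rewrite EX.
by split; [rewrite mem_nth // -has_find | apply/eqP/(nth_find H hX)].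
Qed.

Lemma rep_inj : {in AH &, injective rep}.
Proof. by move=> X Y /repP[_ {2}<-] /repP[_ {2}<-] ->. Qed.

Lemma perm_reps : perm_eq [seq L <- A' | L \in reps] reps.
Proof.
apply: uniq_perm; first by rewrite filter_uniq // fset_uniq.
  by rewrite map_inj_in_uniq ?fset_uniq //; exact: rep_inj.
move=> L; rewrite mem_filter; case: (boolP (L \in reps)) => //= /mapP[X XA ->].
by case: (repP XA).
Qed.

(** One hyperplane is set aside for each member of [AH], injectively, so [size (others A H)] is the
    number d of the theorem; it is also the degree of [terao_poly]. *)
Lemma size_others : (size others + #|` AH| = #|` A'|)%N.
Proof.
have <- : size reps = #|` AH| by rewrite size_map.
by rewrite -(perm_size perm_reps) !size_filter addnC count_predC.
Qed.

Lemma beta_lin L : beta L = lin (hform L - dot (hform L) w *: hform H).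
Proof. exact: retract_lin. Qed.

Lemma beta_vec_neq0 L : L \in A' -> hform L - dot (hform L) w *: hform H != 0.
Proof.
move=> /deletionP[LA LH]; rewrite subr_eq0; apply: contraNneq LH => E.
by apply/eqP/esym; exact: (hform_inj l0 hA HA LA E).
Qed.

Lemma beta_prime L : L \in A' -> prime_elt (beta L).
Proof. by move=> LA; rewrite beta_lin; apply/prime_lin/beta_vec_neq0. Qed.

(** On [H] the form [beta L] agrees with [hform L], and proportional nonzero forms have the same
    kernel. Used in contrapositive: forms with different traces on [H] are coprime. *)
Lemma beta_rdvd L L' : L \in A' -> L' \in A' -> rdvd (beta L) (beta L') ->
  (L :&: H = L' :&: H)%VS.
Proof.
move=> LA L'A; rewrite !beta_lin => /(rdvd_lin (beta_vec_neq0 LA))[c E].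
have c0 : c != 0.
  by apply: contraTneq (beta_vec_neq0 L'A) => c0; rewrite E c0 scale0r eqxx.
have betaE L1 v : v \in H ->
    dot (hform L1 - dot (hform L1) w *: hform H) v = dot (hform L1) v.
  by rewrite (hform_normal l0 hA HA) dotBl dotZl => /eqP ->; rewrite mulr0 subr0.
have [[LA1 _] [L'A1 _]] := (deletionP LA, deletionP L'A).
apply/vspaceP => v; rewrite !memv_cap !(hform_normal l0 hA) // -!(hform_normal l0 hA HA).
apply: andb_id2r => vH.
by rewrite -(betaE L v vH) -(betaE L' v vH) E dotZl mulf_eq0 (negPf c0).
Qed.

Lemma terao_poly_homog : terao_poly \is (size others).-homog.
Proof. by apply: homog_prod_seq => L _; rewrite beta_lin lin_homog. Qed.

Lemma others_deletion L : L \in others -> L \in A'.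
Proof. by rewrite mem_filter => /andP[]. Qed.

Lemma terao_poly_neq0 : terao_poly != 0.
Proof.
rewrite /terao_poly prodf_seq_neq0; apply/allP => L /others_deletion /beta_prime.
by case.
Qed.

Lemma retract_terao : rho terao_poly = terao_poly.
Proof.
by rewrite /terao_poly rmorph_prod; apply: eq_bigr => L _; rewrite /beta /= retractK.
Qed.

Lemma deletion_arrangement : arrangement A'.
Proof. by move=> L /deletionP[/hA]. Qed.

(* Within the pencil of hyperplanes of A' through X, modulo [rep X] the
   derivation is an S-multiple s of the Euler one, which determines
   theta(alpha_H) - s alpha_H up to the other members of the pencil. *)
Lemma pencil_rdvd theta X : X \in AH -> logder A' theta ->
  rdvd (\prod_(L <- [seq L <- others | (L :&: H)%VS == X]) beta L)
       (rho (der_app theta (lin (hform H)))).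
Proof.
move=> XA /(logderP l0 deletion_arrangement) D.
have [RA RX] := repP XA; have [RA1 RH] := deletionP RA.
have [s Es] := D _ RA.
suff [c Ec] : rdvd (\prod_(L <- [seq L <- others | (L :&: H)%VS == X]) lin (hform L))
    (der_app theta (lin (hform H)) - s * lin (hform H)).
  exists (rho c); rewrite -[\prod_(_ <- _) _]rmorph_prod -rmorphM /= -Ec.
  by rewrite rmorphB rmorphM /= retract_form // mulr0 subr0.
have inA L : L \in [seq L <- others | (L :&: H)%VS == X] -> L \in A'.
  by rewrite mem_filter => /andP[_ /others_deletion].
apply: prod_rdvd_coprime.
- by rewrite !filter_uniq // fset_uniq.
- by move=> L /inA/deletionP[LA _]; apply/prime_lin/(hform_neq0 l0 hA LA).
- move=> L L' /inA/deletionP[LA _] /inA/deletionP[L'A _] /eqP LL'.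
  move=> /(rdvd_lin (hform_neq0 l0 hA LA))[c].
  by move/(hform_inj l0 hA LA L'A).
move=> L Lin; have [LA _] := deletionP (inA L Lin).
move: (Lin); rewrite mem_filter => /andP[/eqP LX]; rewrite mem_filter => /andP[Lr LA'].
have RL : rep X != L by apply: contraNneq Lr => <-; apply: map_f.
have [c [e [e0 E]]] := hform_pencil l0 hA HA RA1 LA RH RL (etrans RX (esym LX)).
have [t] := D _ LA'; rewrite {1}E der_app_linD !der_app_linZ Es => Et.
(* Applying [theta] to [E] gives [e] times (theta(alpha_H) - [s] alpha_H) equal to [t - s] times
   alpha_L. *)
exists (e^-1 *: (t - s)).
have -> : lin (hform L) = c *: lin (hform (rep X)) + e *: lin (hform H).
  by rewrite E linD !linZ.
move: Et; rewrite E linD !linZ => Et.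
apply: (scalerI e0); rewrite -scalerAl scalerA mulfV // scale1r mulrBl -Et.
by rewrite -!mul_mpolyC; ring.
Qed.

(** Grouping the factors by their trace on [H] leaves one product per pencil. Each divides by
    [pencil_rdvd], and products for different traces are coprime by [beta_rdvd], so the
    divisibilities multiply. *)
Lemma terao_rdvd theta : logder A' theta ->
  rdvd terao_poly (rho (der_app theta (lin (hform H)))).
Proof.
move=> D; set z := rho _.
have -> : terao_poly =
    \prod_(X <- AH) \prod_(L <- [seq L <- others | (L :&: H)%VS == X]) beta L.
  under eq_bigr do rewrite big_filter.
  rewrite (exchange_big_dep predT) //=; rewrite /terao_poly big_seq [RHS]big_seq.
  apply: eq_bigr => L /others_deletion/restriction_in LX.
  under eq_bigl do rewrite eq_sym.
  by rewrite -big_filter filter_pred1_uniq ?fset_uniq // big_seq1.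
suff P (xs : seq _) : uniq xs -> {subset xs <= AH} ->
    rdvd (\prod_(X <- xs) \prod_(L <- [seq L <- others | (L :&: H)%VS == X]) beta L) z.
  by apply: P; first exact: fset_uniq.
elim: xs => [|X xs IHxs] /=.
  by rewrite big_nil; exists z; rewrite mulr1.
move=> /andP[Xxs uxs] sX; rewrite big_cons.
have XA : X \in AH by apply: sX; rewrite mem_head.
have inA L : L \in [seq L <- others | (L :&: H)%VS == X] -> L \in A'.
  by rewrite mem_filter => /andP[_ /others_deletion].
apply: prod_rdvd_mul => [L /inA/beta_prime //|L Lin||].
- have LA := inA L Lin; move=> /(rdvd_prodP (beta_prime LA))[Y Yxs].
  move=> /(rdvd_prodP (beta_prime LA))[L']; rewrite mem_filter => /andP[/eqP L'Y].
  move=> /others_deletion L'A /(beta_rdvd LA L'A) LL'.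
  move: Lin; rewrite mem_filter LL' L'Y => /andP[/eqP YX _].
  by move: Xxs; rewrite -YX Yxs.
- exact: pencil_rdvd.
- by apply: IHxs => // Y Yxs; apply: sX; rewrite inE Yxs orbT.
Qed.

(** Take the direction [u] in [rep X] with alpha_H(u) = 1, times the forms of all other members of
    [A']. It kills the form of [rep X], and the multiplier handles the others. Its value on alpha_H
    is the multiplier, whose retraction splits into the factors from [others] and from [reps]. *)
Lemma cofactor_derivation X : X \in AH -> exists theta,
  logder A' theta /\ rho (der_app theta (lin (hform H))) =
    terao_poly * \prod_(Y <- AH | Y != X) beta (rep Y).
Proof.
move=> XA; have [RA _] := repP XA; have [RA1 RH] := deletionP RA.
have [u uR uH] : exists2 u, u \in rep X & dot (hform H) u = 1.
  have [v vR vH] : exists2 v, v \in rep X & v \notin H.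
    apply/subvPn; apply: contraNN RH => RsH.
    by rewrite eqEdim RsH (hA RA1) (hA HA) leqnn.
  rewrite (hform_normal l0 hA HA) in vH.
  by exists ((dot (hform H) v)^-1 *: v); rewrite ?memvZ // dotZr mulVf.
exists (const_der (\prod_(L <- A' | L != rep X) lin (hform L)) u); split.
  apply/(logderP l0 deletion_arrangement) => L LA; rewrite der_app_const.
  have [->|LR] := eqVneq L (rep X).
    move: uR; rewrite (hform_normal l0 hA RA1) => /eqP ->.
    by exists 0; rewrite scale0r mul0r.
  rewrite -mul_mpolyC; apply: rdvd_mull.
  rewrite -big_filter (bigD1_seq L) ?filter_uniq ?fset_uniq //=.
    by apply: rdvd_mulr; exists 1; rewrite mul1r.
  by rewrite mem_filter LR LA.
rewrite der_app_const uH scale1r rmorph_prod /= (bigID (mem reps)) /= mulrC.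
congr (_ * _).
  rewrite /terao_poly big_filter; apply: eq_bigl => L.
  case: (boolP (L \in reps)) => //=; rewrite ?andbF ?andbT // => LR.
  by apply: contraNneq LR => ->; apply: map_f.
under eq_bigl do rewrite andbC.
rewrite -big_filter_cond (perm_big _ perm_reps) big_map /=.
rewrite big_seq_cond [RHS]big_seq_cond; apply: eq_bigl => Y.
by apply: andb_id2l => YA; rewrite (inj_in_eq rep_inj).
Qed.

End Deletion.

(** * Bases of derivations *)

Section Bases.
Variables (K : fieldType) (l : nat).
Local Notation S := {mpoly K[l]}.
Local Notation Der := 'rV[S]_l.
Implicit Types (theta : 'I_l -> Der) (M : Der -> Prop).

Lemma generates_mem theta M i : generates theta M -> M (theta i).
Proof.
move=> gen; apply/gen; exists (fun j => (j == i)%:R).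
rewrite (bigD1 i) //= eqxx scale1r big1 ?addr0 // => j /negPf ->.
by rewrite scale0r.
Qed.

Lemma generates_perm theta M (s : {perm 'I_l}) :
  generates theta M -> generates (theta \o s) M.
Proof.
move=> gen x; split=> [/gen[c ->]|[c ->]].
  by exists (c \o s); rewrite (reindex_inj (@perm_inj _ s)).
apply/gen; exists (c \o (s^-1)%g); rewrite [RHS](reindex_inj (@perm_inj _ s)).
by apply: eq_bigr => i _; rewrite /= permK.
Qed.

Lemma independent_perm theta (s : {perm 'I_l}) :
  independent theta -> independent (theta \o s).
Proof.
move=> ind c E i; rewrite -[i](permK s).
apply: (ind (c \o (s^-1)%g)); rewrite -[RHS]E (reindex_inj (@perm_inj _ s)).
by apply: eq_bigr => j _; rewrite /= permK.
Qed.

Section Replace.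
Variables (theta : 'I_l -> Der) (k : 'I_l) (c : 'I_l -> S) (x : K).
Hypotheses (x0 : x != 0) (ck : c k = x%:MP).
Let theta' i := if i == k then \sum_j c j *: theta j else theta i.
Let coef (g : 'I_l -> S) j := if j == k then g k * c k else g j + g k * c j.

Let theta'_sum g : \sum_i g i *: theta' i = \sum_i coef g i *: theta i.
Proof.
rewrite (bigD1 k) // [RHS](bigD1 k) //= /theta' /coef eqxx (bigD1 k) //=.
rewrite scalerDr scalerA -addrA scaler_sumr -big_split; congr (_ + _).
apply: eq_bigr => i /negPf ik; rewrite ik scalerDl scalerA.
by rewrite addrC.
Qed.

Lemma generates_replace M : generates theta M -> generates theta' M.
Proof.
move=> gen y; split=> [/gen[g ->]|[g ->]]; last first.
  by apply/gen; exists (coef g); rewrite theta'_sum.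
(* The coefficient at [k] is divided by the unit [c k]; the other coefficients compensate for what
   [h] times the new element brings in. *)
pose h : S := g k * x^-1%:MP; exists (fun j => if j == k then h else g j - h * c j).
rewrite theta'_sum; apply: eq_bigr => i _; congr (_ *: _); rewrite /coef eqxx.
case: eqP => [->|_]; last by rewrite subrK.
by rewrite /h ck -mulrA -mpolyCM mulVf // mpolyC1 mulr1.
Qed.

Lemma independent_replace : independent theta -> independent theta'.
Proof.
move=> ind g; rewrite theta'_sum => /ind g0.
have gk : g k = 0.
  have := g0 k; rewrite /coef eqxx ck => /eqP.
  by rewrite mulf_eq0 mpolyC_eq0 (negPf x0) orbF => /eqP.
move=> i; have := g0 i; rewrite /coef gk !mul0r addr0.
by case: eqP => [->|].
Qed.

End Replace.
End Bases.

(** * The Euler derivation as a basis element *)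

Section Euler.
Variables (K : fieldType) (l : nat).
Local Notation S := {mpoly K[l]}.
Local Notation Der := 'rV[S]_l.

Lemma logder_euler (A : {fset {vspace 'rV[K]_l}}) : logder A (euler K l).
Proof.
by move=> L _ _ /defining_formP[a -> _]; exists 1; rewrite der_app_euler mul1r.
Qed.

(** As all degrees are positive, the degree 1 part of an expansion of the Euler derivation has
    scalar coefficients, supported on elements of degree 1. One of them is nonzero; that element is
    swapped into position [k], whose minimal degree is then also 1, and exchanged for the Euler
    derivation. *)
Lemma euler_basis (A : {fset {vspace 'rV[K]_l}}) (d : l.-tuple nat) theta (k : 'I_l) :
  (forall i, der_homog (tnth d i) (theta i)) ->
  generates theta (logder A) -> independent theta ->
  (forall i, 0 < tnth d k <= tnth d i)%N ->
  exists theta' : 'I_l -> Der, [/\ theta' k = euler K l,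
    forall i, der_homog (tnth d i) (theta' i),
    generates theta' (logder A) & independent theta'].
Proof.
move=> hom gen ind dk; have [c Ec] := (gen _).1 (@logder_euler A).
pose c' i := if (tnth d i <= 1)%N then pihomog mdeg (1 - tnth d i) (c i) else 0.
have Ec' : euler K l = \sum_i c' i *: theta i.
  apply/rowP => j; rewrite summxE.
  have -> : euler K l 0 j = pihomog mdeg 1 (euler K l 0 j).
    by rewrite pihomog_dE // mxE dhomogX /= mdeg1.
  rewrite Ec summxE raddf_sum; apply: eq_bigr => i _; rewrite /= !mxE.
  by rewrite (pihomogM _ _ (hom i j)) /c'; case: leqP => // _; rewrite mul0r.
have d1 i : (tnth d i <= 1)%N -> tnth d i = 1%N by have := dk i; lia.
have [i ci] : exists i, c' i != 0.
  have : euler K l != 0.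
    apply/eqP => /rowP/(_ k); rewrite !mxE => /eqP.
    by rewrite -msupp_eq0 msuppX.
  rewrite Ec'; case: (pickP (fun i => c' i != 0)) => [i ci _|c0]; first by exists i.
  by rewrite big1 ?eqxx // => i _; have := c0 i; case: eqP => // -> _; rewrite scale0r.
have c'C i1 : c' i1 = ((c' i1)@_0%MM)%:MP.
  rewrite /c'; case: leqP => [/d1 ->|_]; last by rewrite mcoeff0 mpolyC0.
  by apply: homog0C; apply: pihomogP.
have di : tnth d i = 1%N.
  by apply: d1; move: ci; rewrite /c'; case: leqP => // _; rewrite eqxx.
have dk1 : tnth d k = 1%N by have := dk i; rewrite di; lia.
pose s := tperm i k; pose th := theta \o s.
have thE : euler K l = \sum_j (c' \o s) j *: th j.
  by rewrite Ec' (reindex_inj (@perm_inj _ s)).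
have sk : (c' \o s) k = ((c' i)@_0%MM)%:MP by rewrite /= /s tpermR; exact: c'C.
have x0 : (c' i)@_0%MM != 0 by apply: contraNneq ci => E; rewrite c'C E mpolyC0.
exists (fun j => if j == k then \sum_j (c' \o s) j *: th j else th j); split.
- by rewrite eqxx thE.
- move=> j; have [->|jk] := eqVneq j k.
    by rewrite -thE dk1 => j'; rewrite mxE dhomogX /= mdeg1.
  rewrite /th /= /s; case: tpermP => [->|jk'|_ _]; last exact: hom.
    by rewrite di -dk1; apply: hom.
  by rewrite jk' eqxx in jk.
- by apply: (generates_replace x0 sk); apply: generates_perm.
- by apply: (independent_replace x0 sk); apply: independent_perm.
Qed.

End Euler.

(** * From a basis of D(A') to generators of D(A) *)

Section Addition.
Variables (K : fieldType) (l : nat).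
Variables (A : {fset {vspace 'rV[K]_l}}) (H : {vspace 'rV[K]_l}).
Hypotheses (l0 : (0 < l)%N) (hA : arrangement A) (HA : H \in A).
Variable w : 'rV[K]_l.
Hypothesis Hw : dot (hform H) w = 1.
Local Notation S := {mpoly K[l]}.
Local Notation Der := 'rV[S]_l.
Local Notation A' := (deletion A H).
Local Notation AH := (restriction A H).
Local Notation rho := (retract (hform H) w).
Local Notation alpha := (lin (hform H)).
Local Notation B := (terao_poly A H w).
Local Notation D := (size (others A H)).

Variables (d : l.-tuple nat) (theta : 'I_l -> Der).
Hypothesis theta_homog : forall i, der_homog (tnth d i) (theta i).
Hypothesis theta_gen : generates theta (logder A').
Hypothesis theta_ind : independent theta.

Lemma logder_addition delta :
  logder A delta <-> logder A' delta /\ rho (der_app delta alpha) = 0.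
Proof.
have A'_arr := deletion_arrangement (H := H) hA.
split=> [/(logderP l0 hA) DA|[/(logderP l0 A'_arr) DA' DH]].
  split; last by apply/(rdvd_linE Hw)/DA.
  by apply/(logderP l0 A'_arr) => L /deletionP[LA _]; apply: DA.
apply/(logderP l0 hA) => L LA; have [->|LH] := eqVneq L H.
  exact/(rdvd_linE Hw).
by apply: DA'; rewrite in_fsetD1 LH LA.
Qed.

(** The quotient is fixed by [rho] because the dividend and [B] are. Zero is a separate case, as
    [tnth d i] may then be smaller than [D]. *)
Lemma residue_exists : exists f : 'I_l -> S, forall i,
  [/\ rho (der_app (theta i) alpha) = f i * B, rho (f i) = f i &
      f i = 0 \/ (D <= tnth d i)%N /\ f i \is (tnth d i - D).-homog].
Proof.
have /fin_all_exists : forall i, exists fi, rho (der_app (theta i) alpha) = fi * B.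
  by move=> i; apply: terao_rdvd => //; apply: generates_mem.
case=> f fE; exists f => i; split => //.
- apply: (mulIf (terao_poly_neq0 l0 hA HA w)).
  by rewrite -fE -[in LHS](retract_terao A Hw) -rmorphM /= -fE retractK.
- apply: homog_quotient (fE i); first exact: terao_poly_neq0.
  + exact: terao_poly_homog.
  + by apply/retract_homog/der_app_homog.
Qed.

Section Residues.
Variable f : 'I_l -> S.
Hypothesis f_res : forall i, rho (der_app (theta i) alpha) = f i * B.
Hypothesis f_rho : forall i, rho (f i) = f i.
Hypothesis f_homog :
  forall i, f i = 0 \/ (D <= tnth d i)%N /\ f i \is (tnth d i - D).-homog.

Lemma residue_sum c :
  rho (der_app (\sum_i c i *: theta i) alpha) = (\sum_i rho (c i) * f i) * B.
Proof.
rewrite der_app_sum rmorph_sum mulr_suml; apply: eq_bigr => i _.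
by rewrite rmorphM /= f_res mulrA.
Qed.

Lemma logder_residue c :
  logder A (\sum_i c i *: theta i) <-> \sum_i rho (c i) * f i = 0.
Proof.
rewrite logder_addition residue_sum; split=> [[_ /eqP]|->]; last first.
  by rewrite mul0r; split=> //; apply/theta_gen; exists c.
by rewrite mulf_eq0 (negPf (terao_poly_neq0 l0 hA HA w)) orbF => /eqP.
Qed.

Lemma logder_coef delta : logder A delta ->
  exists2 c, delta = \sum_i c i *: theta i & \sum_i rho (c i) * f i = 0.
Proof.
move=> DA; have [/theta_gen[c Ec] _] := (logder_addition delta).1 DA.
by exists c => //; apply/logder_residue; rewrite -Ec.
Qed.

Lemma logder_basis i : logder A (theta i) <-> f i = 0.
Proof.
rewrite logder_addition f_res; split=> [[_ /eqP]|->]; last first.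
  by rewrite mul0r; split=> //; apply: generates_mem theta_gen.
by rewrite mulf_eq0 (negPf (terao_poly_neq0 l0 hA HA w)) orbF => /eqP.
Qed.

(** Expanding [cofactor_derivation] in the basis and cancelling [B] puts each cofactor into the
    ideal of the residues. *)
Lemma cofactor_residue X : X \in AH -> exists c,
  \prod_(Y <- AH | Y != X) beta H w (rep A H Y) = \sum_i rho (c i) * f i.
Proof.
move=> /(cofactor_derivation l0 hA HA w)[delta [/theta_gen[c ->]]].
rewrite residue_sum => E; exists c.
by apply: (mulIf (terao_poly_neq0 l0 hA HA w)); rewrite E mulrC.
Qed.

Lemma cofactor_neq0 X :
  \prod_(Y <- AH | Y != X) beta H w (rep A H Y) != 0.
Proof.
rewrite -big_filter prodf_seq_neq0; apply/allP => Y.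
rewrite mem_filter => /andP[_ /repP[RA _]] /=.
by case: (beta_prime l0 hA HA w RA).
Qed.

(** * The case of a residue dividing all others *)

Section Pivot.
Variables (k : 'I_l) (r : 'I_l -> S).
Hypotheses (fk : f k != 0) (rk : r k = 1).
Hypothesis fr : forall i, f i = r i * f k.
Hypothesis r_rho : forall i, rho (r i) = r i.
Hypothesis r_homog : forall i, i != k ->
  r i = 0 \/ (tnth d k <= tnth d i)%N /\ r i \is (tnth d i - tnth d k).-homog.

Let theta' i := if i == k then alpha *: theta k else theta i - r i *: theta k.
Let coef (g : 'I_l -> S) i :=
  if i == k then alpha * g k - \sum_(j | j != k) g j * r j else g i.

Let theta'_sum g : \sum_i g i *: theta' i = \sum_i coef g i *: theta i.
Proof.
rewrite (bigD1 k) // [RHS](bigD1 k) //= /theta' /coef eqxx scalerA.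
rewrite scalerBl -addrA mulrC; congr (_ + _); rewrite [in RHS]scaler_suml.
rewrite [RHS]addrC -sumrB; apply: eq_bigr => i /negPf ->.
by rewrite scalerBr scalerA.
Qed.

(** Subtracting [r i *: theta k] kills the residue of every other basis element. The remaining
    coefficient of [theta k] must be a multiple of [alpha], so only the exponent at [k] grows, by
    one. *)
Lemma free_of_pivot : free_arrangement A.
Proof.
exists [tuple if i == k then (tnth d k).+1 else tnth d i | i < l], theta'; split.
- move=> i j; rewrite tnth_mktuple /theta'; case: eqP => [_|/eqP ik].
    by rewrite mxE -[(tnth d k).+1]add1n dhomogM ?lin_homog // theta_homog.
  rewrite !mxE rpredB ?theta_homog //.
  have [->|[dki hr]] := r_homog ik; first by rewrite mul0r rpred0.
  by rewrite -(subnK dki) dhomogM // theta_homog.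
- move=> delta; split=> [/logder_coef[c -> c0]|[g ->]]; last first.
    rewrite theta'_sum; apply/logder_residue.
    rewrite (bigD1 k) //= /coef eqxx rmorphB rmorphM /= retract_form // mul0r sub0r.
    rewrite rmorph_sum mulNr mulr_suml addrC; apply/eqP; rewrite subr_eq0; apply/eqP.
    by apply: eq_bigr => i /negPf ->; rewrite rmorphM /= r_rho (fr i) mulrA.
  (* Cancelling [f k] from [c0] shows that [alpha] divides this sum; the quotient [t] is the
     coefficient of [theta' k]. *)
  have /(rdvd_linE Hw)[t Et] : rho (\sum_i c i * r i) = 0.
    apply: (mulIf fk); rewrite mul0r -[RHS]c0 rmorph_sum mulr_suml.
    by apply: eq_bigr => i _; rewrite rmorphM /= r_rho (fr i) mulrA.
  exists (fun i => if i == k then t else c i); rewrite theta'_sum.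
  apply: eq_bigr => i _; congr (_ *: _); rewrite /coef eqxx.
  have [->|//] := eqVneq i k; rewrite mulrC -Et (bigD1 k) //= rk mulr1.
  rewrite -addrA -sumrB big1 ?addr0 // => j /negPf ->; exact: subrr.
- move=> g; rewrite theta'_sum => /theta_ind g0.
  have gj j : j != k -> g j = 0.
    by move=> /negPf jk; have := g0 j; rewrite /coef jk.
  move=> i; have [->|/gj //] := eqVneq i k.
  have := g0 k; rewrite /coef eqxx big1 ?subr0 => [/eqP|j /gj ->]; last exact: mul0r.
  by rewrite mulf_eq0 lin_eq0 (negPf (hform_neq0 l0 hA HA)) => /eqP.
Qed.

End Pivot.

(** A nonzero residue of degree 0 is a unit, hence serves as pivot. *)
Lemma free_of_const k : f k != 0 -> tnth d k = D -> free_arrangement A.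
Proof.
move=> fk dk; have [f0|[_]] := f_homog k; first by rewrite f0 eqxx in fk.
rewrite dk subnn => /homog0C fkC; set x := (f k)@_0%MM in fkC.
have x0 : x != 0 by apply: contraNneq fk => x0; rewrite fkC x0 mpolyC0.
apply: (@free_of_pivot k (fun i => x^-1%:MP * f i)) => //.
- by rewrite fkC -mpolyCM mulVf // mpolyC1.
- by move=> i; rewrite mulrAC fkC -mpolyCM mulVf // mpolyC1 mul1r.
- by move=> i; rewrite rmorphM /= retractC f_rho.
move=> i _; rewrite dk; have [->|[Di fi]] := f_homog i; first by rewrite mulr0; left.
by right; rewrite mul_mpolyC rpredZ.
Qed.

Lemma free_of_single k : f k != 0 -> (forall i, i != k -> f i = 0) ->
  free_arrangement A.
Proof.
move=> fk f0; apply: (@free_of_pivot k (fun i => (i == k)%:R)) => //.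
- by rewrite eqxx.
- by move=> i; have [->|/f0 ->] := eqVneq i k; rewrite ?mul1r ?mul0r.
- by move=> i; rewrite rmorph_nat.
- by move=> i /negPf ->; left.
Qed.

(** * The case of exactly two nonzero residues *)

Section Pair.
Variables i1 i2 : 'I_l.
Hypothesis i12 : i1 != i2.
Hypothesis f0 : forall i, i != i1 -> i != i2 -> f i = 0.
Hypotheses (f1 : f i1 != 0) (f2 : f i2 != 0).

Let sum2 (V : nmodType) (F : 'I_l -> V) :
  \sum_i F i = F i1 + (F i2 + \sum_(i | (i != i1) && (i != i2)) F i).
Proof. by rewrite (bigD1 i1) //= (bigD1 i2) //= eq_sym. Qed.

Lemma residue_sum2 c : \sum_i rho (c i) * f i = rho (c i1) * f i1 + rho (c i2) * f i2.
Proof.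
by rewrite sum2 big1 ?addr0 // => i /andP[i1i i2i]; rewrite f0 ?mulr0.
Qed.

(* The ideal spanned by the two residues contains the cofactors
   [cofactor_residue], whose gcd is 1. *)
Lemma residue_coprime c c' : AH != fset0 ->
  rho c * f i1 + rho c' * f i2 = 0 ->
  exists e, rho c = e * f i2 /\ rho c' = - (e * f i1).
Proof.
move=> AH0 E.
have [e Ee] : rdvd (f i2) (rho c).
  apply: (@rdvd_cofactors _ _ (enum_fset AH) (fun Y => beta H w (rep A H Y))) => //.
  - by move=> Y /repP[RA _]; apply: (beta_prime l0 hA HA w RA).
  - move=> X Y /repP[RX XE] /repP[RY YE] /eqP XY.
    by move=> /(beta_rdvd l0 hA HA RX RY); rewrite XE YE.
  - move=> X /cofactor_residue[u ->]; rewrite residue_sum2.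
    exists (rho c * rho (u i2) - rho (u i1) * rho c').
    have Ec : rho c * f i1 = - (rho c' * f i2) by apply/eqP; rewrite -addr_eq0 E.
    transitivity (rho (u i1) * (rho c * f i1) + rho c * rho (u i2) * f i2).
      by ring.
    by rewrite Ec; ring.
exists e; split => //; apply: (mulIf f2); apply: (addrI (rho c * f i1)).
by rewrite E Ee; ring.
Qed.

Lemma sum_option (V : nmodType) (F : option 'I_l -> V) :
  \sum_j F j = \sum_i F (Some i) + F None.
Proof.
rewrite (bigD1 None) //= addrC; congr (_ + _).
rewrite (reindex_onto Some (odflt i1)) => [|[i|] //].
by apply: eq_bigl => i /=; rewrite eqxx.
Qed.

Let theta' i := if (i == i1) || (i == i2) then alpha *: theta i else theta i.
Let phi := f i2 *: theta i1 - f i1 *: theta i2.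
(** These are the coefficients of [alpha *: phi = f i2 *: theta' i1 - f i1 *: theta' i2] with all
    terms moved to the side of [phi]. *)
Let rel i : S := if i == i1 then - f i2 else if i == i2 then f i1 else 0.
Let coef (g : 'I_l -> S) (c : S) i :=
  if i == i1 then alpha * g i + c * f i2
  else if i == i2 then alpha * g i - c * f i1 else g i.

Let gens_sum g c :
  \sum_i g i *: theta' i + c *: phi = \sum_i coef g c i *: theta i.
Proof.
rewrite !sum2 /theta' /coef /phi !eqxx orbT (eq_sym i2) (negPf i12) /=.
rewrite scalerBr !scalerA !(mulrC alpha) scalerDl scalerBl.
rewrite [in RHS](eq_bigr (fun i => g i *: theta i)); last first.
  by move=> i /andP[/negPf -> /negPf ->].
rewrite [in LHS](eq_bigr (fun i => g i *: theta i)); last first.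
  by move=> i /andP[/negPf -> /negPf ->].
move: (\sum_(i | _) _) => T.
by rewrite addrACA; congr (_ + _); rewrite addrAC.
Qed.

Let exact_pair g c : \sum_i g i *: theta' i + c *: phi = 0 <->
  exists h, (forall i, g i = h * rel i) /\ c = h * alpha.
Proof.
have a0 : alpha != 0 by rewrite lin_eq0 (hform_neq0 l0 hA HA).
have i21 : i2 != i1 by rewrite eq_sym.
rewrite gens_sum; split=> [/theta_ind E|[h [gE ->]]]; last first.
  rewrite big1 // => i _; rewrite /coef gE /rel.
  case: eqP => _; first by rewrite [X in X *: _](_ : _ = 0) ?scale0r //; ring.
  case: eqP => _; first by rewrite [X in X *: _](_ : _ = 0) ?scale0r //; ring.
  by rewrite mulr0 scale0r.
have E1 := E i1; rewrite /coef eqxx in E1.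
have E2 := E i2; rewrite /coef eqxx (negPf i21) in E2.
(* Retracting [E1] kills its [alpha] term and leaves [rho c * f i2 = 0]. *)
have /(rdvd_linE Hw)[h Eh] : rho c = 0.
  apply: (mulIf f2); rewrite mul0r -[in LHS]f_rho -rmorphM.
  have -> : c * f i2 = - (alpha * g i1).
    by apply/eqP; rewrite -addr_eq0 addrC E1.
  by rewrite rmorphN rmorphM /= retract_form // mul0r oppr0.
exists h; split=> // i; rewrite /rel; have [->|ii1] := eqVneq i i1.
  apply: (mulfI a0); apply: (addIr (c * f i2)); rewrite E1 Eh; ring.
have [->|ii2] := eqVneq i i2.
  apply: (mulfI a0); apply: (addIr (- (c * f i1))); rewrite E2 Eh; ring.
by have := E i; rewrite /coef (negPf ii1) (negPf ii2) mulr0.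
Qed.

Lemma spog_of_pair (e : l.-tuple nat) : AH != fset0 ->
  (forall i : 'I_l, i = 0%N :> nat -> [/\ i != i1, i != i2 & theta i = euler K l]) ->
  (forall i, tnth e i = if (i == i1) || (i == i2) then (tnth d i).+1 else tnth d i) ->
  (D < tnth d i1)%N -> (D < tnth d i2)%N ->
  strictly_plus_one_generated A e (tnth d i1 + tnth d i2 - D).
Proof.
move=> AH0 eul eE D1 D2.
have hf i : f i != 0 -> f i \is (tnth d i - D).-homog.
  by move=> fi; case: (f_homog i) => [E|[]//]; rewrite E eqxx in fi.
have := (hf _ f1, hf _ f2) => -[h1 h2].
have rel_homog i : rel i \is ((tnth d i1 + tnth d i2 - D).+1 - tnth e i).-homog.
  rewrite /rel eE; case: (eqVneq i i1) => [->|ii1] /=.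
    by rewrite rpredN subSS addnC -addnBAC ?(ltnW D2) // addnK.
  case: (eqVneq i i2) => [->|ii2]; last exact: rpred0.
  by rewrite subSS -addnBAC ?(ltnW D1) // addnK.
exists theta', phi, alpha, rel; split; last by rewrite lin_eq0 (hform_neq0 l0 hA HA).
split.
- by move=> i /eul[ii1 ii2 E]; rewrite /theta' (negPf ii1) (negPf ii2).
- move=> i j; rewrite eE /theta'; case: ifP => _; last exact: theta_homog.
  by rewrite mxE -[(tnth d i).+1]add1n dhomogM ?lin_homog // theta_homog.
- move=> j; rewrite !mxE rpredB //.
    have -> : (tnth d i1 + tnth d i2 - D = (tnth d i2 - D) + tnth d i1)%N by lia.
    by rewrite dhomogM // theta_homog.
  have -> : (tnth d i1 + tnth d i2 - D = (tnth d i1 - D) + tnth d i2)%N by lia.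
  by rewrite dhomogM // theta_homog.
- move=> delta; split=> [/logder_coef[c ->]|[c ->]]; last first.
    rewrite sum_option /= gens_sum; apply/logder_residue; rewrite residue_sum2.
    rewrite /coef !eqxx (eq_sym i2) (negPf i12) rmorphD rmorphB !rmorphM /=.
    by rewrite retract_form // !f_rho; ring.
  rewrite residue_sum2 => /(residue_coprime AH0)[h [E1 E2]].
  (* The retracted coefficients at [i1] and [i2] together contribute [h *: phi]; what they differ by
     from [c i1] and [c i2] is divisible by [alpha] and goes to [theta' i1] and [theta' i2]. *)
  have [s Es] := retract_mod (hform H) w (c i1); rewrite E1 in Es.
  have [t Et] := retract_mod (hform H) w (c i2); rewrite E2 in Et.
  exists (fun o => if o is Some i then
    (if i == i1 then s else if i == i2 then t else c i) else h).
  rewrite sum_option /= gens_sum; apply: eq_bigr => i _; congr (_ *: _).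
  rewrite /coef; case: (eqVneq i i1) => [->|_]; first by rewrite mulrC -Es subrK.
  by case: (eqVneq i i2) => [->|_] //; rewrite mulrC -Et opprK addrK.
- move=> i c /eqP E.
  (* A redundant generator would give a relation with coefficient -1. By [exact_pair] each
     coefficient is a multiple of a form of positive degree or zero; for [f i1] and [f i2] the
     degree is positive by [D1] and [D2]. *)
  pose c' j : S := if j == i then -1 else c j.
  have : \sum_j c' j *: po_gens theta' phi j = 0.
    rewrite (bigD1 i) //= /c' eqxx scaleN1r (eqP E) addrC; apply/eqP.
    rewrite subr_eq0; apply/eqP; apply: eq_bigr => j /negPf -> //.
  rewrite sum_option /= => /exact_pair[h [E1 E2]].
  have {E1 E2} : (c' i).@[fun=> 0] = 0.
    case: i {E} c' E1 E2 => [i|] c' E1 E2.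
      rewrite E1 mevalM /rel; case: ifP => _.
        by rewrite mevalN (homog_meval0 _ h2) ?oppr0 ?mulr0 //; lia.
      case: ifP => _; last by rewrite meval0 mulr0.
      by rewrite (homog_meval0 _ h1) ?mulr0 //; lia.
    by rewrite E2 mevalM (homog_meval0 _ (lin_homog _)) ?mulr0.
  by rewrite /c' eqxx mevalN meval1 => /eqP; rewrite oppr_eq0 oner_eq0.
- exact: lin_homog.
- move=> i m mi.
  have := dhomog_mf (rel_homog i) mi => /= ->; rewrite subnK //.
  (* The truncated subtraction in [rel_homog] is exact at [i1] and [i2] by [D2] and [D1]; elsewhere
     [rel i] has empty support. *)
  move: mi; rewrite /rel eE; case: (eqVneq i i1) => [-> _|ii1] /=.
    by rewrite ltnS -addnBA ?(ltnW D2) ?leq_addr.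
  case: (eqVneq i i2) => [-> _|_]; last by rewrite msupp0.
  by rewrite ltnS -addnBAC ?(ltnW D1) ?leq_addl.
- exact: exact_pair.
- move=> h _ /eqP; rewrite mulf_eq0 lin_eq0 (negPf (hform_neq0 l0 hA HA)) orbF.
  by move/eqP.
Qed.

End Pair.

End Residues.
End Addition.

(** * Consequences of essentiality *)

Section Essential.
Variables (K : fieldType) (l : nat) (A : {fset {vspace 'rV[K]_l}}).
Hypotheses (hA : arrangement A) (hess : essential A).

Lemma essential_mem (v : 'rV[K]_l) : (forall L, L \in A -> v \in L) -> v = 0.
Proof.
move=> vA; apply/eqP; rewrite -memv0 -hess big_seq.
by elim/big_ind: _ => [|U V vU vV|L /vA //]; rewrite ?memvf // memv_cap vU.
Qed.

(** A linear form divides a scalar only if the scalar is 0, so the vector of constant coefficients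
    lies in every hyperplane. *)
Lemma logder_const theta : (0 < l)%N ->
  logder A theta -> der_homog 0 theta -> theta = 0.
Proof.
move=> l0 /(logderP l0 hA) DA h0; pose v := \row_i (theta 0 i)@_0%MM : 'rV[K]_l.
have thE i : theta 0 i = (v 0 i)%:MP by rewrite mxE; apply: homog0C.
suff v0 : v = 0 by apply/rowP => i; rewrite thE v0 !mxE mpolyC0.
apply: essential_mem => L LA; rewrite (hform_normal l0 hA LA); apply/eqP.
apply: (rdvd_linC (hform_neq0 l0 hA LA)).
have -> : (dot (hform L) v)%:MP = der_app theta (lin (hform L)); last exact: DA.
rewrite der_app_lin raddf_sum; apply: eq_bigr => i _.
by rewrite /= thE mpolyCM mul_mpolyC.
Qed.

(** If [H] were the only hyperplane, essentiality would make it zero, against its dimension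
    [l.-1]. *)
Lemma restriction_neq0 H : (1 < l)%N -> H \in A -> restriction A H != fset0.
Proof.
move=> l1 HA; have [E|[L LA]] := fset_0Vmem (deletion A H); last first.
  by apply/fset0Pn; exists (L :&: H)%VS; apply: restriction_in.
suff H0 : H = 0%VS by have := hA HA; rewrite H0 dimv0; lia.
apply/eqP; rewrite -subv0; apply/subvP => v vH; rewrite memv0; apply/eqP.
apply: essential_mem => L LA; have [->//|LH] := eqVneq L H.
by have : L \in deletion A H; [rewrite in_fsetD1 LH | rewrite E in_fset0].
Qed.

End Essential.

(** * Case distinction on the residues *)

Theorem theorem1p9 (K : fieldType) (l : nat) (hl : (3 <= l)%N)
    (A : {fset {vspace 'rV[K]_l}}) (hA : arrangement A) (hess : essential A)
    (H : {vspace 'rV[K]_l}) (hH : H \in A)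
    (d : l.-tuple nat) (hd : sorted leq d)
    (hfree : free_with_exp (deletion A H) d)
    (hle : (nth 0%N d (l - 3))%:Z <=
           #|` deletion A H|%:Z - #|` restriction A H|%:Z) :
  free_arrangement A \/
  exists lev : nat,
    lev%:Z = (nth 0%N d (l - 2))%:Z + (nth 0%N d (l - 1))%:Z
             - #|` A|%:Z + #|` restriction A H|%:Z + 1 /\
    strictly_plus_one_generated A
      [tuple (if (i < l - 2)%N then tnth d i else (tnth d i).+1) | i < l] lev.
Proof.
have l0 : (0 < l)%N by lia.
have [w Hw] := dot_neq0 (hform_neq0 l0 hA hH).
have sD := size_others A H.
have cA : #|` A| = (1 + #|` deletion A H|)%N by rewrite (cardfsD1 H) hH.
have mono (i j : 'I_l) : (i <= j)%N -> (tnth d i <= tnth d j)%N.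
  move=> ij; rewrite !(tnth_nth 0%N).
  by apply: (sorted_leq_nth leq_trans leqnn 0%N hd); rewrite ?inE ?size_tuple.
(* Indices count from 0, so the entry at [l - 3] is d_{l-2}. *)
have small (i : 'I_l) : (i < l - 2)%N -> (tnth d i <= size (others A H))%N.
  move=> il; have l3 : (l - 3 < l)%N by lia.
  apply: (leq_trans (mono i (Ordinal l3) _)); first by rewrite /=; lia.
  by rewrite (tnth_nth 0%N) -lez_nat (le_trans hle) // -sD PoszD addrK.
pose k0 := Ordinal l0.
have [theta [hom gen ind]] := hfree.
(* If d_1 = 0, then [theta k0] is constant and, [A] being essential, not in D(A). Its residue is
   therefore nonzero, of degree 0, and [A] is free. *)
have [dk0|dk0] := posnP (tnth d k0).
  left; have [f fP] := residue_exists l0 hA hH Hw hom gen.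
  have fres i := let: And3 r _ _ := fP i in r.
  have frho i := let: And3 _ r _ := fP i in r.
  have fhom i := let: And3 _ _ r := fP i in r.
  have fk0 : f k0 != 0.
    apply/eqP => /(logder_basis l0 hA hH Hw gen fres) DA.
    have th0 : theta k0 = 0.
      by apply: (logder_const hA hess l0 DA); rewrite -dk0; apply: hom.
    suff /eqP : (1 : {mpoly K[l]}) = 0 by rewrite oner_eq0.
    have := ind (fun i => (i == k0)%:R) _ k0; rewrite eqxx; apply.
    by rewrite (bigD1 k0) //= th0 scaler0 big1 ?addr0 // => i /negPf ->; rewrite scale0r.
  apply: (free_of_const l0 hA hH Hw hom gen ind fres frho fhom fk0).
  by case: (fhom k0) => [E|[]]; [rewrite E eqxx in fk0 | rewrite dk0; lia].
have {theta hom gen ind} [theta [eul hom gen ind]] : exists theta : 'I_l -> 'rV_l,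
    [/\ theta k0 = euler K l, forall i, der_homog (tnth d i) (theta i),
     generates theta (logder (deletion A H)) & independent theta].
  by apply: (euler_basis hom gen ind) => i; rewrite dk0 mono.
have [f fP] := residue_exists l0 hA hH Hw hom gen.
have fres i := let: And3 r _ _ := fP i in r.
have frho i := let: And3 _ r _ := fP i in r.
have fhom i := let: And3 _ _ r := fP i in r.
have AH0 := restriction_neq0 hA hess (ltnW hl) hH.
have l1 : (l - 2 < l)%N by lia.
have l2 : (l - 1 < l)%N by lia.
pose i1 := Ordinal l1; pose i2 := Ordinal l2.
have i12 : i1 != i2 by rewrite -val_eqE /=; lia.
have iE (i : 'I_l) : (i < l - 2)%N = (i != i1) && (i != i2).
  by rewrite -!val_eqE /=; have := ltn_ord i; lia.
case: (pickP (fun i => (f i != 0) && (tnth d i == size (others A H)))) => [i|nc].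
  move=> /andP[fi /eqP di]; left.
  exact: (free_of_const l0 hA hH Hw hom gen ind fres frho fhom fi di).
have big i : f i != 0 -> (size (others A H) < tnth d i)%N.
  move=> fi; have := nc i; rewrite fi /= ltn_neqAle eq_sym => -> /=.
  by case: (fhom i) => [E|[]//]; rewrite E eqxx in fi.
(* By [small], a nonzero residue here would have degree 0, a case already settled. *)
have f0 i : i != i1 -> i != i2 -> f i = 0.
  move=> ii1 ii2; apply/eqP; apply: contraT => /big; rewrite ltnNge small //.
  by rewrite iE ii1.
(* Otherwise every cofactor, a combination of the residues, would be zero. *)
have fn0 : exists i, f i != 0.
  have /fset0Pn[X /(cofactor_residue l0 hA hH gen fres)[c Ec]] := AH0.
  case: (pickP (fun i => f i != 0)) => [i fi|fz]; first by exists i.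
  have := cofactor_neq0 l0 hA hH w X; rewrite Ec big1 ?eqxx // => i _.
  by have := fz i; case: eqP => // -> _; rewrite mulr0.
have single k : f k != 0 -> (forall i, i != k -> f i = 0) -> free_arrangement A.
  exact: (free_of_single l0 hA hH Hw hom gen ind fres).
have [f1|f1] := eqVneq (f i1) 0.
  left; case: fn0 => k fk; apply: (single k fk) => i ik.
  have Ek : k = i2.
    apply/eqP; apply: contraTT fk => ki2; rewrite negbK; apply/eqP.
    by have [->|ki1] := eqVneq k i1; last exact: f0.
  by have [->|ii1] := eqVneq i i1; last by apply: f0; rewrite // -Ek.
have [f2|f2] := eqVneq (f i2) 0.
  by left; apply: (single i1 f1) => i ii1; have [->|] := eqVneq i i2; last exact: f0.
(* This is the stated level, since |A| = |A'| + 1; [le1] makes the truncated subtraction exact. *)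
right; exists (tnth d i1 + tnth d i2 - size (others A H))%N; split.
  have le1 := leq_trans (ltnW (big _ f1)) (leq_addr (tnth d i2) (tnth d i1)).
  by rewrite -(subzn le1) !(tnth_nth 0%N) cA -sD !PoszD /=; ring.
apply: (spog_of_pair l0 hA hH Hw hom gen ind fres frho fhom i12 f0 f1 f2) => //.
- move=> i i0; have /andP[] : (i != i1) && (i != i2) by rewrite -iE i0; lia.
  split => //; rewrite -eul; congr theta; exact: val_inj.
- by move=> i; rewrite tnth_mktuple iE -negb_or; case: (_ || _).
- exact: big.
- exact: big.
Qed.
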